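(* Let $C$ be a coalgebra and $H$ a finite dimensional weak Hopf algebra over a field $\Bbbk$, with dual weak Hopf algebra $H^*$. Then the following are equivalent: (i) $C$ is a left partial $H$-comodule coalgebra; (ii) $C$ is a right partial $H^*$-module coalgebra. Moreover, $C$ is a left symmetric partial $H$-comodule coalgebra if and only if $C$ is a right symmetric partial $H^*$-module coalgebra.
   Context: All tensor products are over the field $\Bbbk$, all maps are $\Bbbk$-linear, and $V\otimes\Bbbk\simeq V\simeq\Bbbk\otimes V$ is used as an identification; coalgebras are coassociative and counital; Sweedler notation $\Delta(h)=h_1\otimes h_2$ is used, and $\tau_{V,W}:V\otimes W\to W\otimes V$ is the flip. $I_V$ is the identity map of $V$. A weak bialgebra $(H,m,u,\Delta,\varepsilon)$ is a vector space that is both an algebra and a coalgebra such that for all $h,k,\ell\in H$: (i) $\Delta(hk)=\Delta(h)\Delta(k)$; (ii) $\varepsilon(hk\ell)=\varepsilon(hk_1)\varepsilon(k_2\ell)=\varepsilon(hk_2)\varepsilon(k_1\ell)$; (iii) $(1_H\otimes\Delta(1_H))(\Delta(1_H)\otimes 1_H)=(\Delta(1_H)\otimes 1_H)(1_H\otimes\Delta(1_H))=\Delta^2(1_H)$, where $\Delta^2=(\Delta\otimes I)\Delta$. With $\Delta(1_H)=1_1\otimes 1_2$, define $\varepsilon_t(h)=\varepsilon(1_1h)1_2$ and $\varepsilon_s(h)=1_1\varepsilon(h1_2)$. A weak Hopf algebra is a weak bialgebra with a linear map $S:H\to H$ (antipode) such that $h_1S(h_2)=\varepsilon_t(h)$,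 $S(h_1)h_2=\varepsilon_s(h)$, $S(h_1)h_2S(h_3)=S(h)$ for all $h\in H$. For $H$ finite dimensional, $H^*=\mathrm{Hom}(H,\Bbbk)$ is a weak Hopf algebra with product $(f*g)(h)=f(h_1)g(h_2)$, unit $1_{H^*}=\varepsilon_H$, coproduct $\Delta_{H^*}(f)=f_1\otimes f_2$ determined by $f(hk)=f_1(h)f_2(k)$ for all $h,k\in H$, and counit $\varepsilon_{H^*}(f)=f(1_H)$. A coalgebra $C$ is a (left) partial $H$-comodule coalgebra if there is a linear map $\overline{\rho}:C\to H\otimes C$ such that for all $c\in C$: (CCP1) $(\varepsilon_H\otimes I_C)\overline{\rho}(c)=c$; (CCP2) $(I_H\otimes\Delta_C)\overline{\rho}(c)=(m_H\otimes I_C\otimes I_C)(I_H\otimes\tau_{C,H}\otimes I_C)(\overline{\rho}\otimes\overline{\rho})\Delta_C(c)$; (CCP3) $(I_H\otimes\overline{\rho})\overline{\rho}(c)=(m_H\otimes I_H\otimes I_C)[(I_H\otimes\varepsilon_C)(\overline{\rho}(c_1))\otimes(\Delta_H\otimes I_C)(\overline{\rho}(c_2))]$. It is a symmetric one if in addition $(I_H\otimes\overline{\rho})\overline{\rho}(c)=(m_H\otimes I_H\otimes I_C)(I_H\otimes\tau_{H\otimes C,H})[(\Delta_H\otimes I_C)(\overline{\rho}(c_1))\otimes(I_H\otimes\varepsilon_C)(\overline{\rho}(c_2))]$ for all $c\in C$. For a weak Hopf algebra $K$, a coalgebra $C$ is a (right) partial $K$-module coalgebra if there is a linear map $\leftharpoonup:C\otimes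 K\to C$ such that for all $c\in C$, $h,k\in K$: $c\leftharpoonup 1_K=c$; $\Delta_C(c\leftharpoonup h)=(c_1\leftharpoonup h_1)\otimes(c_2\leftharpoonup h_2)$; $(c\leftharpoonup h)\leftharpoonup k=\varepsilon_C(c_1\leftharpoonup h_1)\,(c_2\leftharpoonup h_2k)$. It is a symmetric one if in addition $(c\leftharpoonup h)\leftharpoonup k=(c_1\leftharpoonup h_1k)\,\varepsilon_C(c_2\leftharpoonup h_2)$. *)

(* Defs.v *)
From HB Require Import structures.
From mathcomp Require Import all_boot all_order all_algebra.
From mathcomp Require Import generic_quotient boolp.

Set Implicit Arguments.
Unset Strict Implicit.
Unset Printing Implicit Defensive.

Import GRing.Theory.
Local Open Scope ring_scope.
Local Open Scope quotient_scope.

Reserved Notation "x ⊗ y" (at level 40, left associativity).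
Reserved Notation "x ∙ y" (at level 40, left associativity).
Reserved Notation "\sw_ ( x , y <- t ) F"
  (at level 41, x name, y name, t at level 41, F at level 41,
   format "'[' \sw_ ( x ,  y  <-  t ) '/  '  F ']'").

Section Tensor.
Variables (K : fieldType) (V W : lmodType K).
Implicit Types (s t : seq (V * W)).

Definition fsum (U : nmodType) (f : V -> W -> U) s : U :=
  \sum_(p <- s) f p.1 p.2.

(* A list of pairs stands for the sum of the corresponding pure tensors; two
   lists are the same tensor when no bilinear map tells them apart. *)
Definition tensor_eq : rel (seq (V * W)) := fun s t =>
  `[< forall (U : lmodType K) (f : {bilinear V -> W -> U}),
        fsum f s = fsum f t >].

Lemma tensor_eq_equiv : equiv_class_of tensor_eq.
Proof.
split=> [s|s t|s t u] /=.
- exact/asboolP.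
- by apply/idP/idP => /asboolP H; apply/asboolP => U f; rewrite H.
- by move=> /asboolP H1 /asboolP H2; apply/asboolP => U f; rewrite H1.
Qed.

Canonical tensor_equiv := EquivRelPack tensor_eq_equiv.

Definition tensor : Type := {eq_quot tensor_equiv}.
HB.instance Definition _ := Choice.on tensor.
HB.instance Definition _ := EqQuotient.on tensor.

Definition tpi (s : seq (V * W)) : tensor := \pi s.

Definition tpure (v : V) (w : W) : tensor := tpi [:: (v, w)].

(* Sweedler sum: f is applied to the summands of a chosen decomposition of t
   into pure tensors.  For f bilinear the choice is immaterial (tlift_tpi). *)
Definition tlift (U : nmodType) (t : tensor) (f : V -> W -> U) : U :=
  fsum f (repr t).

Definition bilin (U : lmodType K) (f : V -> W -> U) :=
  (forall w, linear (f^~ w)) /\ (forall v, linear (f v)).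

Section BilinPack.
Variables (U : lmodType K) (f : V -> W -> U) (bf : bilin f).
Definition mkbilin : V -> W -> U := f.
HB.instance Definition _ := bilinear_isBilinear.Build K V W U *:%R *:%R
  mkbilin (bf.1, bf.2).
Definition bilin_pack : {bilinear V -> W -> U} := mkbilin.
End BilinPack.

Lemma bilinear_bilin (U : lmodType K) (f : {bilinear V -> W -> U}) : bilin f.
Proof.
split=> [w|v] a x y /=.
- by rewrite linearPl.
- by rewrite linearPr.
Qed.

Lemma tlift_tpi (U : lmodType K) (f : V -> W -> U) s :
  bilin f -> tlift (tpi s) f = fsum f s.
Proof.
move=> bf.
have /eqmodP /asboolP H : repr (\pi_tensor s) = s %[mod tensor] by rewrite reprK.
exact: (H U (bilin_pack bf)).
Qed.

Lemma tlift_pure (U : lmodType K) (f : V -> W -> U) v w :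
  bilin f -> tlift (tpure v w) f = f v w.
Proof. by move=> bf; rewrite tlift_tpi // /fsum big_seq1. Qed.

Lemma tensor_ext (x y : tensor) :
  (forall (U : lmodType K) (f : V -> W -> U),
     bilin f -> tlift x f = tlift y f) -> x = y.
Proof.
move=> H; rewrite -[x]reprK -[y]reprK; apply/eqmodP/asboolP => U f.
exact: (H U f (bilinear_bilin f)).
Qed.

Definition tzero : tensor := tpi [::].
Definition tadd (x y : tensor) : tensor := tpi (repr x ++ repr y).
Definition tscale (a : K) (x : tensor) : tensor :=
  tpi [seq (a *: p.1, p.2) | p <- repr x].
Definition topp (x : tensor) : tensor := tscale (- 1) x.

Lemma bilinP (U : lmodType K) (f : V -> W -> U) : bilin f ->
  (forall a v v' w, f (a *: v + v') w = a *: f v w + f v' w) /\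
  (forall a v w w', f v (a *: w + w') = a *: f v w + f v w').
Proof. by case=> H1 H2; split=> *; [apply: H1 | apply: H2]. Qed.

Lemma bilin0l (U : lmodType K) (f : V -> W -> U) w : bilin f -> f 0 w = 0.
Proof.
move=> [H _]; have := H w (-1) 0 0.
by rewrite scaler0 addr0 scaleN1r addNr.
Qed.

Lemma bilinZl (U : lmodType K) (f : V -> W -> U) a v w :
  bilin f -> f (a *: v) w = a *: f v w.
Proof.
move=> bf; have [H _] := bf; have := H w a v 0.
by rewrite !addr0 (bilin0l _ bf) addr0.
Qed.

Lemma tlift0 (U : lmodType K) (f : V -> W -> U) : bilin f -> tlift tzero f = 0.
Proof. by move=> bf; rewrite tlift_tpi // /fsum big_nil. Qed.

Lemma tliftD (U : lmodType K) (f : V -> W -> U) x y : bilin f ->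
  tlift (tadd x y) f = tlift x f + tlift y f.
Proof. by move=> bf; rewrite tlift_tpi // /fsum big_cat. Qed.

Lemma tliftZ (U : lmodType K) (f : V -> W -> U) a x : bilin f ->
  tlift (tscale a x) f = a *: tlift x f.
Proof.
move=> bf; rewrite tlift_tpi // /fsum big_map scaler_sumr.
by apply: eq_bigr => p _ /=; rewrite bilinZl.
Qed.

Lemma taddA : associative tadd.
Proof. by move=> x y z; apply: tensor_ext => U f bf; rewrite !tliftD // addrA. Qed.
Lemma taddC : commutative tadd.
Proof. by move=> x y; apply: tensor_ext => U f bf; rewrite !tliftD // addrC. Qed.
Lemma tadd0 : left_id tzero tadd.
Proof. by move=> x; apply: tensor_ext => U f bf; rewrite tliftD // tlift0 // add0r. Qed.
Lemma taddN : left_inverse tzero topp tadd.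
Proof.
move=> x; apply: tensor_ext => U f bf.
by rewrite tliftD // tliftZ // tlift0 // scaleN1r addNr.
Qed.

HB.instance Definition _ := GRing.isZmodule.Build tensor taddA taddC tadd0 taddN.

Lemma tscaleA a b x : tscale a (tscale b x) = tscale (a * b) x.
Proof. by apply: tensor_ext => U f bf; rewrite !tliftZ // scalerA. Qed.
Lemma tscale1 : left_id 1 tscale.
Proof. by move=> x; apply: tensor_ext => U f bf; rewrite tliftZ // scale1r. Qed.
Lemma tscaleDr : right_distributive tscale +%R.
Proof.
by move=> a x y; apply: tensor_ext => U f bf; rewrite !(tliftZ, tliftD) // scalerDr.
Qed.
Lemma tscaleDl x : {morph tscale^~ x : a b / a + b}.
Proof.
by move=> a b; apply: tensor_ext => U f bf; rewrite !(tliftZ, tliftD) // scalerDl.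
Qed.

HB.instance Definition _ := GRing.Zmodule_isLmodule.Build K tensor
  tscaleA tscale1 tscaleDr tscaleDl.

End Tensor.

Arguments tensor {K} (V W)%_type.
Notation "V ⊗ W" := (tensor V W) : type_scope.
Notation "v ⊗ w" := (tpure v w) : ring_scope.
Notation "\sw_ ( x , y <- t ) F" := (tlift t (fun x y => F)) : ring_scope.

Section TensorTheory.
Variables (K : fieldType).
Implicit Types (U V W X : lmodType K).

Lemma tlift_linear V W U (f : V -> W -> U) :
  bilin f -> linear (fun t : V ⊗ W => tlift t f).
Proof. by move=> bf a x y; rewrite [LHS]tliftD // tliftZ. Qed.

Lemma tliftP V W U (f : V -> W -> U) a (x y : V ⊗ W) :
  bilin f -> tlift (a *: x + y) f = a *: tlift x f + tlift y f.
Proof. by move=> bf; apply: tlift_linear. Qed.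

Lemma tpure_bilin V W : bilin (@tpure K V W).
Proof.
split=> [w|v] a x y; apply: tensor_ext => U f bf;
  by rewrite /= tliftP // !tlift_pure //; case: (bilinP bf).
Qed.

Lemma linear_at0 V W (f : V -> W) : linear f -> f 0 = 0.
Proof. by move=> lf; have := lf (-1) 0 0; rewrite scaler0 addr0 scaleN1r addNr. Qed.

Lemma linear_atZ V W (f : V -> W) a v : linear f -> f (a *: v) = a *: f v.
Proof. by move=> lf; have := lf a v 0; rewrite (linear_at0 lf) !addr0. Qed.

Lemma linear_sum V W (f : V -> W) : linear f ->
  forall (I : Type) (r : seq I) (F : I -> V),
  f (\sum_(i <- r) F i) = \sum_(i <- r) f (F i).
Proof.
move=> lf I r F.
elim: r => [|i r IH]; first by rewrite !big_nil (linear_at0 lf).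
by rewrite !big_cons -IH -[F i]scale1r lf !scale1r.
Qed.

Lemma tensor_decomp V W (t : V ⊗ W) : t = \sw_(v, w <- t) (v ⊗ w).
Proof.
apply: tensor_ext => U f bf.
symmetry; apply: etrans (linear_sum (tlift_linear bf) _ _) _ => /=.
by apply: eq_bigr => p _; rewrite tlift_pure.
Qed.

Lemma linear_ext V W U (f g : V ⊗ W -> U) : linear f -> linear g ->
  (forall v w, f (v ⊗ w) = g (v ⊗ w)) -> f =1 g.
Proof.
move=> lf lg fg t; rewrite (tensor_decomp t) /tlift /fsum.
by rewrite !linear_sum //; apply: eq_bigr.
Qed.

Lemma eq_tlift V W (U : nmodType) (f g : V -> W -> U) (t : V ⊗ W) :
  f =2 g -> tlift t f = tlift t g.
Proof. by move=> fg; apply: eq_bigr => p _; apply: fg. Qed.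

Lemma tlift_comp V W U X (g : U -> X) (f : V -> W -> U) (t : V ⊗ W) :
  linear g -> g (tlift t f) = \sw_(v, w <- t) g (f v w).
Proof. by move=> lg; rewrite /tlift /fsum linear_sum. Qed.

Lemma linear_param X V W U (F : X -> V -> W -> U) (t : V ⊗ W) :
  (forall v w, linear (fun x => F x v w)) ->
  linear (fun x => tlift t (F x)).
Proof.
move=> lF a x y; rewrite /tlift /fsum scaler_sumr -big_split /=.
by apply: eq_bigr => p _; rewrite lF.
Qed.

Lemma linear_arg X V W U (f : V -> W -> U) (g : X -> V ⊗ W) :
  bilin f -> linear g -> linear (fun x => tlift (g x) f).
Proof. by move=> bf lg a x y; rewrite lg (tlift_linear bf). Qed.

Lemma linear_id V : linear (fun x : V => x).
Proof. by []. Qed.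

Lemma linear_comp V W U (f : W -> U) (g : V -> W) :
  linear f -> linear g -> linear (fun x => f (g x)).
Proof. by move=> lf lg a x y; rewrite lg lf. Qed.

Lemma linear_lin V W U (f : {linear W -> U}) (g : V -> W) :
  linear g -> linear (fun x => f (g x)).
Proof. by move=> lg a x y; rewrite lg linearP. Qed.

Lemma linear_lin0 V W (f : {linear V -> W}) : linear f.
Proof. exact: linearP. Qed.

Lemma linear_tpurel V W U (f : U -> V) (w : W) :
  linear f -> linear (fun x => f x ⊗ w).
Proof. by move=> lf a x y; rewrite lf; apply: (tpure_bilin V W).1. Qed.

Lemma linear_tpurer V W U (f : U -> W) (v : V) :
  linear f -> linear (fun x => v ⊗ f x).
Proof. by move=> lf a x y; rewrite lf; apply: (tpure_bilin V W).2. Qed.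

Lemma linear_scalel V U (f : U -> K^o) (v : V) :
  linear f -> linear (fun x => f x *: v).
Proof. by move=> lf a x y; rewrite lf scalerDl scalerA. Qed.

Lemma linear_scaler V U (f : U -> V) (b : K) :
  linear f -> linear (fun x => b *: f x).
Proof. by move=> lf a x y; rewrite lf scalerDr !scalerA mulrC. Qed.

End TensorTheory.


Section TensorMaps.
Variables (K : fieldType).
Implicit Types (U V W X : lmodType K).

Definition tmap U V W X (f : U -> W) (g : V -> X) (t : U ⊗ V) : W ⊗ X :=
  \sw_(u, v <- t) f u ⊗ g v.

Definition tswap V W (t : V ⊗ W) : W ⊗ V := \sw_(v, w <- t) w ⊗ v.

Definition tassoc U V W (t : (U ⊗ V) ⊗ W) : U ⊗ (V ⊗ W) :=
  \sw_(x, w <- t) \sw_(u, v <- x) u ⊗ (v ⊗ w).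

Definition tassocV U V W (t : U ⊗ (V ⊗ W)) : (U ⊗ V) ⊗ W :=
  \sw_(u, x <- t) \sw_(v, w <- x) (u ⊗ v) ⊗ w.

(* I ⊗ τ ⊗ I, with factors grouped in pairs on both sides *)
Definition tmid U V W X (t : (U ⊗ V) ⊗ (W ⊗ X)) : (U ⊗ W) ⊗ (V ⊗ X) :=
  \sw_(x, y <- t) \sw_(u, v <- x) \sw_(w, z <- y) (u ⊗ w) ⊗ (v ⊗ z).

(* the identifications K ⊗ V = V = V ⊗ K *)
Definition tunitl V (t : K^o ⊗ V) : V := \sw_(a, v <- t) a *: v.
Definition tunitr V (t : V ⊗ K^o) : V := \sw_(v, a <- t) a *: v.

End TensorMaps.

(* The library's algType requires 1 != 0; the zero algebra is allowed here. *)
HB.mixin Record isUAlgebra (K : fieldType) A of GRing.Lmodule K A := {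
  amul : A -> A -> A;
  aone : A;
  amul_bilin : bilin amul;
  amulA : associative amul;
  amul1l : left_id aone amul;
  amul1r : right_id aone amul
}.

#[short(type="ualgType")]
HB.structure Definition UAlgebra (K : fieldType) :=
  {A of GRing.Lmodule K A & isUAlgebra K A}.

Notation "x ∙ y" := (amul x y) : ring_scope.
Notation "𝟏" := aone : ring_scope.

Section AlgLinear.
Variables (K : fieldType) (A : ualgType K) (V : lmodType K).

Lemma linear_mull (f : V -> A) (b : A) :
  linear f -> linear (fun x => f x ∙ b).
Proof. by move=> lf a x y; rewrite lf; apply: amul_bilin.1. Qed.

Lemma linear_mulr (f : V -> A) (b : A) :
  linear f -> linear (fun x => b ∙ f x).
Proof. by move=> lf a x y; rewrite lf; apply: amul_bilin.2. Qed.

Lemma linear_Kmull (f : V -> K^o) (b : K^o) :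
  linear f -> linear (fun x => f x * b : K^o).
Proof. by move=> lf a x y; rewrite lf mulrDl -scalerAl. Qed.

Lemma linear_Kmulr (f : V -> K^o) (b : K^o) :
  linear f -> linear (fun x => b * f x : K^o).
Proof. by move=> lf a x y; rewrite lf mulrDr -scalerAr. Qed.

End AlgLinear.

Ltac lin_step := first
  [ exact: linear_id
  | exact: linear_lin0
  | apply: linear_tpurel
  | apply: linear_tpurer
  | apply: linear_mull
  | apply: linear_mulr
  | apply: linear_Kmull
  | apply: linear_Kmulr
  | apply: linear_scalel
  | apply: linear_scaler
  | apply: linear_lin
  | apply: linear_param => ? ? /=
  | apply: linear_arg
  | (split=> ? /=) ].
Ltac lin := repeat lin_step.

Section TensorMapsTheory.
Variables (K : fieldType).
Implicit Types (U V W X : lmodType K).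

Lemma tmap_pure U V W X (f : U -> W) (g : V -> X) u v :
  linear f -> linear g -> tmap f g (u ⊗ v) = f u ⊗ g v.
Proof. by move=> lf lg; rewrite /tmap tlift_pure //; lin. Qed.

Lemma tmap_linear U V W X (f : U -> W) (g : V -> X) :
  linear f -> linear g -> linear (tmap f g).
Proof. by move=> lf lg; apply: tlift_linear; lin. Qed.

Lemma tassoc_linear U V W : linear (@tassoc K U V W).
Proof. by apply: tlift_linear; lin. Qed.

Lemma tassoc_pure U V W (u : U) (v : V) (w : W) :
  tassoc ((u ⊗ v) ⊗ w) = u ⊗ (v ⊗ w).
Proof. by rewrite /tassoc !tlift_pure //; lin. Qed.

Lemma tassocV_pure U V W (u : U) (v : V) (w : W) :
  tassocV (u ⊗ (v ⊗ w)) = (u ⊗ v) ⊗ w.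
Proof. by rewrite /tassocV !tlift_pure //; lin. Qed.

Lemma tassocV_linear U V W : linear (@tassocV K U V W).
Proof. by apply: tlift_linear; lin. Qed.

Lemma tmid_linear U V W X : linear (@tmid K U V W X).
Proof. by apply: tlift_linear; lin. Qed.

Lemma tmid_pure U V W X (u : U) (v : V) (w : W) (x : X) :
  tmid ((u ⊗ v) ⊗ (w ⊗ x)) = (u ⊗ w) ⊗ (v ⊗ x).
Proof. by rewrite /tmid !tlift_pure //; lin. Qed.

Lemma tunitl_linear V : linear (@tunitl K V).
Proof. by apply: tlift_linear; lin. Qed.

Lemma tunitl_pure V a (v : V) : tunitl (a ⊗ v) = a *: v.
Proof. by rewrite /tunitl tlift_pure //; lin. Qed.

Lemma tunitr_linear V : linear (@tunitr K V).
Proof. by apply: tlift_linear; lin. Qed.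

Lemma tunitr_pure V a (v : V) : tunitr (v ⊗ a) = a *: v.
Proof. by rewrite /tunitr tlift_pure //; lin. Qed.

End TensorMapsTheory.

HB.mixin Record isCoalgebra (K : fieldType) C of GRing.Lmodule K C := {
  comul : {linear C -> (C ⊗ C)%type};
  counit : {linear C -> K^o};
  comulA : forall c,
    tassoc (tmap comul idfun (comul c)) = tmap idfun comul (comul c);
  comul_unitl : forall c, tunitl (tmap counit idfun (comul c)) = c;
  comul_unitr : forall c, tunitr (tmap idfun counit (comul c)) = c
}.

#[short(type="coalgType")]
HB.structure Definition Coalgebra (K : fieldType) :=
  {C of GRing.Lmodule K C & isCoalgebra K C}.

Notation Δ := comul.
Notation ε := counit.

Section Mult.
Variables (K : fieldType) (A : ualgType K).

Definition amulT (t : A ⊗ A) : A := \sw_(x, y <- t) x ∙ y.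

End Mult.

Section TensorAlgebra.
Variables (K : fieldType) (A B : ualgType K).

Definition tmul (x y : A ⊗ B) : A ⊗ B := tmap (@amulT K A) (@amulT K B) (tmid (x ⊗ y)).

Lemma tmulE (x y : A ⊗ B) :
  tmul x y = \sw_(a, b <- x) \sw_(c, d <- y) (a ∙ c) ⊗ (b ∙ d).
Proof.
have lA : linear (@amulT K A) by apply: tlift_linear; exact: amul_bilin.
have lB : linear (@amulT K B) by apply: tlift_linear; exact: amul_bilin.
rewrite /tmul /tmid tlift_pure; last by lin.
rewrite (tlift_comp _ _ (tmap_linear lA lB)); apply: eq_tlift => a b.
rewrite (tlift_comp _ _ (tmap_linear lA lB)); apply: eq_tlift => c d.
by rewrite tmap_pure // /amulT !tlift_pure //; apply: amul_bilin.
Qed.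

Lemma tmul_bilin : bilin tmul.
Proof.
split=> [y|x] a u v; rewrite !tmulE.
- by apply: (tlift_linear _ a u v); lin.
- by move: a u v; rewrite -/(linear _); lin.
Qed.

Lemma tmul_pure a b c d : tmul (a ⊗ b) (c ⊗ d) = (a ∙ c) ⊗ (b ∙ d).
Proof. by rewrite tmulE !tlift_pure //; lin. Qed.

Lemma linear_tmull (V : lmodType K) (f : V -> A ⊗ B) (y : A ⊗ B) :
  linear f -> linear (fun x => tmul (f x) y).
Proof. by move=> lf a u v; rewrite lf; apply: tmul_bilin.1. Qed.

Lemma linear_tmulr (V : lmodType K) (f : V -> A ⊗ B) (y : A ⊗ B) :
  linear f -> linear (fun x => tmul y (f x)).
Proof. by move=> lf a u v; rewrite lf; apply: tmul_bilin.2. Qed.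

Lemma tmulA : associative tmul.
Proof.
move=> x y z.
apply: (@linear_ext _ _ _ _ (fun x => tmul x (tmul y z))
          (fun x => tmul (tmul x y) z)) => [||a a'].
- by apply: linear_tmull; lin.
- by do 2 apply: linear_tmull; lin.
apply: (@linear_ext _ _ _ _ (fun y => tmul (a ⊗ a') (tmul y z))
          (fun y => tmul (tmul (a ⊗ a') y) z)) => [||b b'].
- by apply: linear_tmulr; apply: linear_tmull; lin.
- by apply: linear_tmull; apply: linear_tmulr; lin.
apply: (@linear_ext _ _ _ _ (fun z => tmul (a ⊗ a') (tmul (b ⊗ b') z))
          (fun z => tmul (tmul (a ⊗ a') (b ⊗ b')) z)) => [||c c'].
- by do 2 apply: linear_tmulr; lin.
- by apply: linear_tmulr; lin.
by rewrite !tmul_pure !amulA.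
Qed.

Lemma tmul1l : left_id (𝟏 ⊗ 𝟏) tmul.
Proof.
apply: linear_ext => [||a b]; try by [lin | apply: linear_tmulr; lin].
by rewrite tmul_pure !amul1l.
Qed.

Lemma tmul1r : right_id (𝟏 ⊗ 𝟏) tmul.
Proof.
move=> x; apply: (@linear_ext _ _ _ _ (fun x => tmul x (𝟏 ⊗ 𝟏))
  (fun x => x)) => [||a b]; try by [lin | apply: linear_tmull; lin].
by rewrite tmul_pure !amul1r.
Qed.

HB.instance Definition _ := isUAlgebra.Build K (tensor A B)
  tmul_bilin tmulA tmul1l tmul1r.

End TensorAlgebra.

Lemma amul_pure (K : fieldType) (A B : ualgType K) (a c : A) (b d : B) :
  (a ⊗ b) ∙ (c ⊗ d) = (a ∙ c) ⊗ (b ∙ d).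
Proof. exact: tmul_pure. Qed.

(* In comul1l and comul1r the factors of H ⊗ H ⊗ H are bracketed to the left;
   on tensors, ∙ is the componentwise product (m ⊗ m)(I ⊗ τ ⊗ I). *)
HB.mixin Record isWeakBialgebra (K : fieldType) H
    of UAlgebra K H & Coalgebra K H := {
  comulM : forall h k : H, Δ (h ∙ k) = Δ h ∙ Δ k;
  counitM12 : forall h k l : H,
    ε (h ∙ k ∙ l) = \sw_(k1, k2 <- Δ k) ε (h ∙ k1) * ε (k2 ∙ l);
  counitM21 : forall h k l : H,
    ε (h ∙ k ∙ l) = \sw_(k1, k2 <- Δ k) ε (h ∙ k2) * ε (k1 ∙ l);
  comul1l : tassocV ((𝟏 : H) ⊗ Δ (𝟏 : H)) ∙ (Δ (𝟏 : H) ⊗ (𝟏 : H)) =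
            tmap Δ idfun (Δ (𝟏 : H));
  comul1r : (Δ (𝟏 : H) ⊗ (𝟏 : H)) ∙ tassocV ((𝟏 : H) ⊗ Δ (𝟏 : H)) =
            tmap Δ idfun (Δ (𝟏 : H))
}.

#[short(type="weakBialgType")]
HB.structure Definition WeakBialgebra (K : fieldType) :=
  {H of UAlgebra K H & Coalgebra K H & isWeakBialgebra K H}.

Definition counit_t (K : fieldType) (H : weakBialgType K) (h : H) : H :=
  \sw_(x, y <- Δ (𝟏 : H)) ε (x ∙ h) *: y.

Definition counit_s (K : fieldType) (H : weakBialgType K) (h : H) : H :=
  \sw_(x, y <- Δ (𝟏 : H)) ε (h ∙ y) *: x.

HB.mixin Record isWeakHopf (K : fieldType) H of WeakBialgebra K H := {
  antipode : {linear H -> H};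
  antipode_t : forall h : H,
    \sw_(h1, h2 <- Δ h) h1 ∙ antipode h2 = counit_t h;
  antipode_s : forall h : H,
    \sw_(h1, h2 <- Δ h) antipode h1 ∙ h2 = counit_s h;
  antipode_ss : forall h : H,
    \sw_(h12, h3 <- Δ h) \sw_(h1, h2 <- Δ h12)
      antipode h1 ∙ h2 ∙ antipode h3 = antipode h
}.

#[short(type="weakHopfType")]
HB.structure Definition WeakHopf (K : fieldType) :=
  {H of WeakBialgebra K H & isWeakHopf K H}.

#[short(type="finWeakHopfType")]
HB.structure Definition FinWeakHopf (K : fieldType) :=
  {H of WeakHopf K H & Vector K H}.

Section CoalgebraTheory.
Variables (K : fieldType) (C : coalgType K).

Lemma comulA3 (U : lmodType K) (F : C -> C -> C -> U) (c : C) :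
  (forall y z, linear (fun x => F x y z)) ->
  (forall x z, linear (fun y => F x y z)) ->
  (forall x y, linear (fun z => F x y z)) ->
  \sw_(x, z <- Δ c) \sw_(a, b <- Δ x) F a b z =
  \sw_(a, y <- Δ c) \sw_(b, z <- Δ y) F a b z.
Proof.
move=> F1 F2 F3.
pose G (t : C ⊗ (C ⊗ C)) := \sw_(a, y <- t) \sw_(b, z <- y) F a b z.
have bG : bilin (fun a y => \sw_(b, z <- y) F a b z).
  by split=> [y|a]; [apply: linear_param | apply: tlift_linear; split].
have lG : linear G by apply: tlift_linear.
have /(congr1 G) := comulA c.
rewrite /tmap (tlift_comp _ _ (@tassoc_linear _ C C C)).
rewrite !(tlift_comp _ _ lG) => E.
etransitivity; last (etransitivity; [exact: E|]).
- apply: eq_tlift => x z; rewrite /= /tassoc tlift_pure; last by lin.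
  rewrite (tlift_comp _ _ lG); apply: eq_tlift => a b.
  by rewrite /G tlift_pure // tlift_pure //; split.
- by apply: eq_tlift => a y; rewrite /G tlift_pure.
Qed.

Lemma counitlE (c : C) : \sw_(x, y <- Δ c) ε x *: y = c.
Proof.
rewrite -[RHS]comul_unitl /tmap (tlift_comp _ _ (@tunitl_linear _ _)).
by apply: eq_tlift => x y; rewrite tunitl_pure.
Qed.

Lemma counitrE (c : C) : \sw_(x, y <- Δ c) ε y *: x = c.
Proof.
rewrite -[RHS]comul_unitr /tmap (tlift_comp _ _ (@tunitr_linear _ _)).
by apply: eq_tlift => x y; rewrite tunitr_pure.
Qed.

End CoalgebraTheory.

Definition dual (K : fieldType) (H : finWeakHopfType K) := 'Hom(H, K^o).

Section Dual.
Variables (K : fieldType) (H : finWeakHopfType K).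
Local Notation Hs := (dual H).

HB.instance Definition _ := Vector.on Hs.

Definition dual_lin (f : H -> K^o) (lf : linear f) : {linear H -> K^o} :=
  HB.pack f (GRing.isLinear.Build K H K^o _ f lf).

Lemma linfunE (f : H -> K^o) : linear f -> forall h, (linfun f : Hs) h = f h.
Proof. by move=> lf h; rewrite (lfunE (dual_lin lf)). Qed.

Lemma dual_ext (f g : Hs) : f =1 g -> f = g.
Proof. by move=> fg; apply/lfunP. Qed.

Lemma dual_linear (f : Hs) : linear (f : H -> K^o).
Proof. exact: linearP. Qed.

Lemma linear_eval (V : lmodType K) (g : V -> Hs) (h : H) :
  linear g -> linear (fun x => (g x : Hs) h : K^o).
Proof. by move=> lg a x y; rewrite lg add_lfunE scale_lfunE. Qed.

Definition dual_mul (f g : Hs) : Hs :=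
  linfun (fun h => \sw_(h1, h2 <- Δ h) f h1 * g h2).

Definition dual_one : Hs := linfun (@counit K H).

Lemma dual_mulE f g h : dual_mul f g h = \sw_(h1, h2 <- Δ h) f h1 * g h2.
Proof.
rewrite /dual_mul linfunE //; apply: linear_arg; last exact: linear_lin0.
by split=> ?; [apply: linear_Kmull | apply: linear_Kmulr]; apply: dual_linear.
Qed.

Lemma dual_oneE h : dual_one h = ε h.
Proof. by rewrite /dual_one linfunE //; apply: linear_lin0. Qed.

Lemma dual_mul_bilin : bilin dual_mul.
Proof.
split=> [g|f] a u v; apply: dual_ext => h; rewrite add_lfunE scale_lfunE !dual_mulE.
- rewrite /tlift /fsum scaler_sumr -big_split /=; apply: eq_bigr => p _.
  by rewrite add_lfunE scale_lfunE mulrDl -scalerAl.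
- rewrite /tlift /fsum scaler_sumr -big_split /=; apply: eq_bigr => p _.
  by rewrite add_lfunE scale_lfunE mulrDr -scalerAr.
Qed.

Lemma tlift_mull (V W : lmodType K) (t : V ⊗ W) (F : V -> W -> K^o) (b : K^o) :
  (tlift t F) * b = \sw_(x, y <- t) F x y * b.
Proof. by rewrite /tlift /fsum mulr_suml. Qed.

Lemma tlift_mulr (V W : lmodType K) (t : V ⊗ W) (F : V -> W -> K^o) (b : K^o) :
  b * (tlift t F) = \sw_(x, y <- t) b * F x y.
Proof. by rewrite /tlift /fsum mulr_sumr. Qed.

Lemma dual_mulA : associative dual_mul.
Proof.
move=> f g l; apply: dual_ext => h; rewrite !dual_mulE.
transitivity (\sw_(x, z <- Δ h) \sw_(a, b <- Δ x) (f a * g b * l z : K^o)).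
  rewrite (comulA3 (F := fun a b z => f a * g b * l z : K^o)).
  - apply: eq_tlift => a y; rewrite dual_mulE tlift_mulr.
    by apply: eq_tlift => b z; rewrite mulrA.
  - by move=> y z; do 2 apply: linear_Kmull; apply: dual_linear.
  - by move=> x z; apply: linear_Kmull; apply: linear_Kmulr; apply: dual_linear.
  - by move=> x y; apply: linear_Kmulr; apply: dual_linear.
by apply: eq_tlift => x z; rewrite dual_mulE tlift_mull.
Qed.

Lemma dual_mul1l : left_id dual_one dual_mul.
Proof.
move=> f; apply: dual_ext => h; rewrite dual_mulE.
rewrite -[in RHS](counitlE h) (tlift_comp _ _ (dual_linear f)).
by apply: eq_tlift => x y; rewrite dual_oneE linearZ.
Qed.

Lemma dual_mul1r : right_id dual_one dual_mul.
Proof.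
move=> f; apply: dual_ext => h; rewrite dual_mulE.
rewrite -[in RHS](counitrE h) (tlift_comp _ _ (dual_linear f)).
by apply: eq_tlift => x y; rewrite dual_oneE linearZ /= mulrC.
Qed.

HB.instance Definition _ := isUAlgebra.Build K Hs
  dual_mul_bilin dual_mulA dual_mul1l dual_mul1r.

Local Notation bas := (vbasis (@fullv K H)).

(* The coproduct of f is Σ_i e_i^* ⊗ f(e_i -), for a basis (e_i) of H; dual_comulE
   and dual_comul_uniq show that it is the only one with f(hk) = f_1(h) f_2(k). *)
Definition dual_comul (f : Hs) : Hs ⊗ Hs :=
  \sum_(i < \dim (@fullv K H))
    linfun (coord bas i : H -> K^o) ⊗ linfun (fun k => f (bas`_i ∙ k)).

Definition evl (X : lmodType K) (t : Hs ⊗ X) (h : H) : X :=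
  \sw_(f, x <- t) (f : Hs) h *: x.

Lemma evl_bilin (X : lmodType K) h :
  bilin (fun (f : Hs) (x : X) => f h *: x).
Proof.
split=> [x|f].
- by apply: (@linear_scalel _ _ _ (fun f : Hs => f h : K^o)); apply: linear_eval; lin.
- by apply: linear_scaler; lin.
Qed.

Lemma evl_pure (X : lmodType K) (f : Hs) (x : X) h : evl (f ⊗ x) h = f h *: x.
Proof. by rewrite /evl tlift_pure //; apply: evl_bilin. Qed.

Lemma evl_linear (X : lmodType K) h : linear ((@evl X)^~ h).
Proof. by apply: tlift_linear; apply: evl_bilin. Qed.

Lemma dual_decomp (f : Hs) :
  f = \sum_(i < \dim (@fullv K H)) f (bas`_i) *: linfun (coord bas i : H -> K^o).
Proof.
apply: dual_ext => h; rewrite sum_lfunE /=.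
rewrite {1}(coord_vbasis (memvf h)) linear_sum; last exact: dual_linear.
apply: eq_bigr => i _; rewrite scale_lfunE linearZ /= linfunE; last exact: linearP.
exact: mulrC.
Qed.

Lemma evl_decomp (X : lmodType K) (t : Hs ⊗ X) :
  t = \sum_(i < \dim (@fullv K H)) linfun (coord bas i : H -> K^o) ⊗ evl t (bas`_i).
Proof.
apply: (@linear_ext K Hs X _ (fun t => t) (fun t => \sum_(i < \dim (@fullv K H))
  (linfun (coord bas i : H -> K^o) : Hs) ⊗ evl t (bas`_i))) => [|a x y|f x].
- exact: linear_id.
- rewrite scaler_sumr -big_split /=; apply: eq_bigr => i _.
  by rewrite evl_linear; apply: (tpure_bilin _ _).2.
- rewrite {1}(dual_decomp f) (linear_sum ((tpure_bilin _ _).1 x)) /=.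
  apply: eq_bigr => i _; rewrite evl_pure bilinZl; last exact: tpure_bilin.
  by rewrite (linear_atZ _ _ ((tpure_bilin Hs X).2 _)).
Qed.

Lemma evl_inj (X : lmodType K) (t t' : Hs ⊗ X) : evl t =1 evl t' -> t = t'.
Proof.
by move=> E; rewrite (evl_decomp t) (evl_decomp t'); apply: eq_bigr => i _; rewrite E.
Qed.

Definition ev2 (t : Hs ⊗ Hs) (h k : H) : K^o :=
  \sw_(f, g <- t) (f : Hs) h * (g : Hs) k.

Lemma ev2_evl t h k : ev2 t h k = evl t h k.
Proof.
rewrite /evl /ev2 (tlift_comp _ _ (g := fun f : Hs => f k : K^o)); last by apply: linear_eval; lin.
by apply: eq_tlift => f g; rewrite scale_lfunE.
Qed.

Lemma ev2_inj t t' : (forall h k, ev2 t h k = ev2 t' h k) -> t = t'.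
Proof.
by move=> E; apply: evl_inj => h; apply: dual_ext => k; rewrite -!ev2_evl.
Qed.

Lemma dual_comulE f h k : ev2 (dual_comul f) h k = f (h ∙ k).
Proof.
have lk (k' : H) : linear (fun h => f (h ∙ k') : K^o).
  by apply: linear_lin; apply: linear_mull; lin.
have lh (h' : H) : linear (fun k => f (h' ∙ k) : K^o).
  by apply: linear_lin; apply: linear_mulr; lin.
rewrite ev2_evl /dual_comul (linear_sum (@evl_linear Hs h)) /= sum_lfunE /=.
rewrite {2}(coord_vbasis (memvf h)).
rewrite [RHS](linear_sum (lk k)); apply: eq_bigr => i _.
rewrite evl_pure scale_lfunE !linfunE //; last exact: linearP.
by rewrite (linear_atZ _ _ (lk k)).
Qed.

Lemma dual_comul_uniq (t : Hs ⊗ Hs) (f : Hs) :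
  (forall h k, \sw_(f1, f2 <- t) ((f1 : Hs) h * (f2 : Hs) k) = f (h ∙ k)) ->
  t = dual_comul f.
Proof. by move=> E; apply: ev2_inj => h k; rewrite dual_comulE -E. Qed.

Lemma ev2_bilin h k : bilin (fun f g : Hs => f h * g k : K^o).
Proof.
split=> [g|f].
- by apply: linear_Kmull; apply: linear_eval; lin.
- by apply: linear_Kmulr; apply: linear_eval; lin.
Qed.

Lemma ev2_linear h k : linear (fun t => ev2 t h k).
Proof. by apply: tlift_linear; apply: ev2_bilin. Qed.

Lemma ev2_pure f g h k : ev2 (f ⊗ g) h k = f h * g k.
Proof. by rewrite /ev2 tlift_pure //; apply: ev2_bilin. Qed.

Lemma dual_comul_linear : linear dual_comul.
Proof.
move=> a f g; apply: ev2_inj => h k.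
by rewrite ev2_linear !dual_comulE add_lfunE scale_lfunE.
Qed.

HB.instance Definition _ := GRing.isLinear.Build K Hs (Hs ⊗ Hs)%type _
  dual_comul dual_comul_linear.

Definition dual_counit (f : Hs) : K^o := f 𝟏.

Lemma dual_counit_linear : linear dual_counit.
Proof. by apply: linear_eval; lin. Qed.

HB.instance Definition _ := GRing.isLinear.Build K Hs K^o _
  dual_counit dual_counit_linear.

Definition ev3r (t : Hs ⊗ (Hs ⊗ Hs)) h k l := ev2 (evl t h) k l.

Lemma ev3r_linear h k l : linear (fun t => ev3r t h k l).
Proof. by move=> a x y; rewrite /ev3r evl_linear ev2_linear. Qed.

Lemma ev3r_inj t t' : (forall h k l, ev3r t h k l = ev3r t' h k l) -> t = t'.
Proof. by move=> E; apply: evl_inj => h; apply: ev2_inj => k l; apply: E. Qed.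

Lemma ev2Z a x h k : ev2 (a *: x) h k = a * ev2 x h k.
Proof. exact: (linear_atZ a x (ev2_linear h k)). Qed.

Lemma ev3r_assoc (x : Hs ⊗ Hs) (g : Hs) h k l :
  ev3r (tassoc (x ⊗ g)) h k l = ev2 x h k * g l.
Proof.
apply: (@linear_ext _ _ _ _ (fun x => ev3r (tassoc (x ⊗ g)) h k l)
   (fun x => ev2 x h k * g l : K^o)) => [a u v|a u v|a b].
- by rewrite (tpure_bilin _ _).1 tassoc_linear ev3r_linear.
- by rewrite ev2_linear mulrDl -scalerAl.
- by rewrite tassoc_pure /ev3r evl_pure ev2Z !ev2_pure mulrA.
Qed.

Lemma dual_comulA f :
  tassoc (tmap dual_comul idfun (dual_comul f)) =
  tmap idfun dual_comul (dual_comul f).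
Proof.
apply: ev3r_inj => h k l.
have El : linear (fun t => ev3r (tassoc t) h k l).
  by move=> a u v; rewrite tassoc_linear ev3r_linear.
rewrite /tmap (tlift_comp _ _ El) (tlift_comp _ _ (ev3r_linear h k l)).
transitivity (ev2 (dual_comul f) (h ∙ k) l).
  by apply: eq_tlift => x g; rewrite ev3r_assoc dual_comulE.
rewrite dual_comulE -amulA -dual_comulE.
by apply: eq_tlift => x g; rewrite /ev3r evl_pure ev2Z dual_comulE.
Qed.

Lemma tlift_eval (V W : lmodType K) (t : V ⊗ W) (F : V -> W -> Hs) (h : H) :
  (tlift t F : Hs) h = \sw_(x, y <- t) F x y h.
Proof.
by rewrite (tlift_comp _ _ (g := fun f : Hs => f h : K^o)) //; apply: linear_eval; lin.
Qed.

Lemma dual_counitl f : tunitl (tmap dual_counit idfun (dual_comul f)) = f.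
Proof.
rewrite /tmap (tlift_comp _ _ (@tunitl_linear _ _)); apply: dual_ext => h.
rewrite tlift_eval -[in RHS](amul1l h) -dual_comulE.
by apply: eq_tlift => x y; rewrite tunitl_pure scale_lfunE.
Qed.

Lemma dual_counitr f : tunitr (tmap idfun dual_counit (dual_comul f)) = f.
Proof.
rewrite /tmap (tlift_comp _ _ (@tunitr_linear _ _)); apply: dual_ext => h.
rewrite tlift_eval -[in RHS](amul1r h) -dual_comulE.
by apply: eq_tlift => x y; rewrite tunitr_pure scale_lfunE; apply: mulrC.
Qed.

HB.instance Definition _ := isCoalgebra.Build K Hs
  dual_comulA dual_counitl dual_counitr.

Lemma dmulE (f g : Hs) h : (f ∙ g : Hs) h = \sw_(h1, h2 <- Δ h) f h1 * g h2.
Proof. exact: dual_mulE. Qed.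
Lemma doneE h : (𝟏 : Hs) h = ε h.
Proof. exact: dual_oneE. Qed.
Lemma dcomulE (f : Hs) h k : \sw_(f1, f2 <- Δ f) (f1 : Hs) h * (f2 : Hs) k = f (h ∙ k).
Proof. exact: dual_comulE. Qed.
Lemma dcounitE (f : Hs) : ε f = f 𝟏.
Proof. by []. Qed.

Lemma tlift_swap (V W V' W' : lmodType K) (t : V ⊗ W) (t' : V' ⊗ W')
    (F : V -> W -> V' -> W' -> K^o) :
  \sw_(a, b <- t) \sw_(c, d <- t') F a b c d =
  \sw_(c, d <- t') \sw_(a, b <- t) F a b c d.
Proof. exact: exchange_big. Qed.

Lemma ev2_mul (x y : Hs ⊗ Hs) h k :
  ev2 (x ∙ y) h k =
  \sw_(h1, h2 <- Δ h) \sw_(k1, k2 <- Δ k) (ev2 x h1 k1 * ev2 y h2 k2 : K^o).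
Proof.
have lx y' : linear (fun x => \sw_(h1, h2 <- Δ h) \sw_(k1, k2 <- Δ k)
    (ev2 x h1 k1 * ev2 y' h2 k2 : K^o)).
  by do 2 apply: linear_param => ? ?; apply: linear_Kmull; apply: ev2_linear.
have ly x' : linear (fun y => \sw_(h1, h2 <- Δ h) \sw_(k1, k2 <- Δ k)
    (ev2 x' h1 k1 * ev2 y h2 k2 : K^o)).
  by do 2 apply: linear_param => ? ?; apply: linear_Kmulr; apply: ev2_linear.
apply: (linear_ext (f := fun x => ev2 (x ∙ y) h k) _ (lx y)) => [a u v|a b].
  by rewrite (amul_bilin).1 ev2_linear.
apply: (linear_ext (f := fun y => ev2 ((a ⊗ b) ∙ y) h k) _ (ly _)) => [e u v|c d].
  by rewrite (amul_bilin).2 ev2_linear.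
rewrite amul_pure ev2_pure !dmulE tlift_mull; apply: eq_tlift => h1 h2.
rewrite tlift_mulr; apply: eq_tlift => k1 k2.
by rewrite !ev2_pure mulrACA.
Qed.

Lemma dual_comulM (f g : Hs) : Δ (f ∙ g) = Δ f ∙ Δ g.
Proof.
apply: ev2_inj => h k; rewrite ev2_mul [LHS]dual_comulE dmulE comulM.
pose G (t : H ⊗ H) := \sw_(x, y <- t) (f x * g y : K^o).
have lG : linear G.
  apply: tlift_linear.
  by split=> ?; [apply: linear_Kmull | apply: linear_Kmulr]; apply: dual_linear.
have GE a b : G (a ⊗ b) = f a * g b.
  rewrite /G tlift_pure //.
  by split=> ?; [apply: linear_Kmull | apply: linear_Kmulr]; apply: dual_linear.
rewrite -/(G _) [X in G X](_ : _ = tmul (Δ h) (Δ k)) // tmulE (tlift_comp _ _ lG).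
apply: eq_tlift => h1 h2; rewrite (tlift_comp _ _ lG).
by apply: eq_tlift => k1 k2; rewrite GE -!dcomulE.
Qed.

Definition pair3 (f g l : Hs) (t : (H ⊗ H) ⊗ H) : K^o :=
  \sw_(x, c <- t) \sw_(a, b <- x) f a * g b * l c.

Lemma pair3_bilin (f g l : Hs) :
  bilin (fun (x : H ⊗ H) (c : H) => \sw_(a, b <- x) (f a * g b * l c : K^o)).
Proof.
split=> [c|x].
- apply: tlift_linear; split=> ? /=.
  + by do 2 apply: linear_Kmull; apply: dual_linear.
  + by apply: linear_Kmull; apply: linear_Kmulr; apply: dual_linear.
- by apply: linear_param => a b; apply: linear_Kmulr; apply: dual_linear.
Qed.

Lemma pair3_linear (f g l : Hs) : linear (pair3 f g l).
Proof. exact/tlift_linear/pair3_bilin. Qed.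

Lemma pair3_pure (f g l : Hs) a b c : pair3 f g l ((a ⊗ b) ⊗ c) = f a * g b * l c.
Proof.
rewrite /pair3 tlift_pure; last exact: pair3_bilin.
rewrite tlift_pure //; split=> ? /=.
- by do 2 apply: linear_Kmull; apply: dual_linear.
- by apply: linear_Kmull; apply: linear_Kmulr; apply: dual_linear.
Qed.

Lemma pair3_coassoc (f g l : Hs) : pair3 f g l (tmap Δ idfun (Δ (𝟏 : H))) = (f ∙ g ∙ l) 𝟏.
Proof.
rewrite dmulE /tmap (tlift_comp _ _ (@pair3_linear f g l)).
apply: eq_tlift => x z; rewrite /pair3 tlift_pure; last exact: pair3_bilin.
by rewrite dmulE tlift_mull.
Qed.

Lemma pair3_1l (f g l : Hs) (u v : H ⊗ H) :
  pair3 f g l (tassocV ((𝟏 : H) ⊗ u) ∙ (v ⊗ (𝟏 : H))) =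
  \sw_(p, q <- v) \sw_(r, s <- u) (f p * g (r ∙ q) * l s : K^o).
Proof.
rewrite {1}(tensor_decomp v) {1}(tensor_decomp u).
rewrite (tlift_comp _ _ (g := fun v => pair3 f g l
   (tassocV ((𝟏 : H) ⊗ (\sw_(a, b <- u) (a ⊗ b))) ∙ (v ⊗ (𝟏 : H))))); last first.
  move=> a x y; rewrite (tpure_bilin _ _).1 (amul_bilin).2; exact: pair3_linear.
apply: eq_tlift => p q.
rewrite (tlift_comp _ _ (g := fun u => pair3 f g l
   (tassocV ((𝟏 : H) ⊗ u) ∙ ((p ⊗ q) ⊗ (𝟏 : H))))); last first.
  move=> a x y; rewrite (tpure_bilin _ _).2 tassocV_linear (amul_bilin).1.
  exact: pair3_linear.
apply: eq_tlift => r s.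
by rewrite tassocV_pure !amul_pure pair3_pure amul1l amul1r.
Qed.

Lemma pair3_1r (f g l : Hs) (u v : H ⊗ H) :
  pair3 f g l ((v ⊗ (𝟏 : H)) ∙ tassocV ((𝟏 : H) ⊗ u)) =
  \sw_(p, q <- v) \sw_(r, s <- u) (f p * g (q ∙ r) * l s : K^o).
Proof.
rewrite {1}(tensor_decomp v) {1}(tensor_decomp u).
rewrite (tlift_comp _ _ (g := fun v => pair3 f g l
   ((v ⊗ (𝟏 : H)) ∙ tassocV ((𝟏 : H) ⊗ (\sw_(a, b <- u) (a ⊗ b)))))); last first.
  move=> a x y; rewrite (tpure_bilin _ _).1 (amul_bilin).1; exact: pair3_linear.
apply: eq_tlift => p q.
rewrite (tlift_comp _ _ (g := fun u => pair3 f g l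
   (((p ⊗ q) ⊗ (𝟏 : H)) ∙ tassocV ((𝟏 : H) ⊗ u)))); last first.
  move=> a x y; rewrite (tpure_bilin _ _).2 tassocV_linear (amul_bilin).2.
  exact: pair3_linear.
apply: eq_tlift => r s.
by rewrite tassocV_pure !amul_pure pair3_pure amul1l amul1r.
Qed.

Lemma dual_counitM12 (f g l : Hs) :
  ε (f ∙ g ∙ l) = \sw_(g1, g2 <- Δ g) ε (f ∙ g1) * ε (g2 ∙ l).
Proof.
rewrite dcounitE -pair3_coassoc -comul1r pair3_1r.
transitivity (\sw_(g1, g2 <- Δ g) \sw_(p, q <- Δ (𝟏 : H)) \sw_(r, s <- Δ (𝟏 : H))
    ((f p * (g1 : Hs) q) * ((g2 : Hs) r * l s) : K^o)).
  rewrite [RHS]tlift_swap; apply: eq_tlift => p q; rewrite [RHS]tlift_swap.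
  apply: eq_tlift => r s; rewrite -dcomulE tlift_mulr tlift_mull.
  by apply: eq_tlift => g1 g2; rewrite !mulrA.
apply: eq_tlift => g1 g2; rewrite !dcounitE !dmulE tlift_mull.
by apply: eq_tlift => p q; rewrite tlift_mulr.
Qed.

Lemma dual_counitM21 (f g l : Hs) :
  ε (f ∙ g ∙ l) = \sw_(g1, g2 <- Δ g) ε (f ∙ g2) * ε (g1 ∙ l).
Proof.
rewrite dcounitE -pair3_coassoc -comul1l pair3_1l.
transitivity (\sw_(g1, g2 <- Δ g) \sw_(p, q <- Δ (𝟏 : H)) \sw_(r, s <- Δ (𝟏 : H))
    ((f p * (g2 : Hs) q) * ((g1 : Hs) r * l s) : K^o)).
  rewrite [RHS]tlift_swap; apply: eq_tlift => p q; rewrite [RHS]tlift_swap.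
  apply: eq_tlift => r s; rewrite -dcomulE tlift_mulr tlift_mull.
  by apply: eq_tlift => g1 g2; rewrite mulrA -!mulrA; congr (_ * _); rewrite mulrCA.
apply: eq_tlift => g1 g2; rewrite !dcounitE !dmulE tlift_mull.
by apply: eq_tlift => p q; rewrite tlift_mulr.
Qed.

Definition ev3 (t : (Hs ⊗ Hs) ⊗ Hs) h k l : K^o :=
  \sw_(x, c <- t) ev2 x h k * (c : Hs) l.

Lemma ev3_bilin h k l : bilin (fun x (c : Hs) => ev2 x h k * c l : K^o).
Proof.
split=> [c|x].
- by apply: linear_Kmull; apply: ev2_linear.
- by apply: linear_Kmulr; apply: linear_eval; lin.
Qed.

Lemma ev3_linear h k l : linear (fun t => ev3 t h k l).
Proof. by apply: tlift_linear; apply: ev3_bilin. Qed.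

Lemma ev3_pure x c h k l : ev3 (x ⊗ c) h k l = ev2 x h k * c l.
Proof. by rewrite /ev3 tlift_pure //; apply: ev3_bilin. Qed.

Lemma ev3_assoc t h k l : ev3 t h k l = ev3r (tassoc t) h k l.
Proof.
apply: (linear_ext (g := fun t => ev3r (tassoc t) h k l) (ev3_linear h k l)).
- by move=> a u v; rewrite tassoc_linear ev3r_linear.
- by move=> x c; rewrite ev3_pure ev3r_assoc.
Qed.

Lemma tassocK (U V W : lmodType K) : cancel (@tassoc K U V W) (@tassocV K U V W).
Proof.
move=> t; apply: (linear_ext (f := fun t => tassocV (tassoc t)) (g := fun t => t)).
- by move=> a u v; rewrite tassoc_linear tassocV_linear.
- exact: linear_id.
move=> x w.
apply: (linear_ext (f := fun x => tassocV (tassoc (x ⊗ w))) (g := fun x => x ⊗ w)).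
- by move=> a u v; rewrite (tpure_bilin _ _).1 tassoc_linear tassocV_linear.
- by lin.
by move=> u v; rewrite tassoc_pure tassocV_pure.
Qed.

Lemma ev3_inj t t' : (forall h k l, ev3 t h k l = ev3 t' h k l) -> t = t'.
Proof.
move=> E; apply: (can_inj (@tassocK Hs Hs Hs)); apply: ev3r_inj => h k l.
by rewrite -!ev3_assoc.
Qed.

Lemma ev3_mul (x y : (Hs ⊗ Hs) ⊗ Hs) h k l :
  ev3 (x ∙ y) h k l =
  \sw_(h1, h2 <- Δ h) \sw_(k1, k2 <- Δ k) \sw_(l1, l2 <- Δ l)
    (ev3 x h1 k1 l1 * ev3 y h2 k2 l2 : K^o).
Proof.
have lx y' : linear (fun x => \sw_(h1, h2 <- Δ h) \sw_(k1, k2 <- Δ k)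
    \sw_(l1, l2 <- Δ l) (ev3 x h1 k1 l1 * ev3 y' h2 k2 l2 : K^o)).
  by do 3 apply: linear_param => ? ?; apply: linear_Kmull; apply: ev3_linear.
have ly x' : linear (fun y => \sw_(h1, h2 <- Δ h) \sw_(k1, k2 <- Δ k)
    \sw_(l1, l2 <- Δ l) (ev3 x' h1 k1 l1 * ev3 y h2 k2 l2 : K^o)).
  by do 3 apply: linear_param => ? ?; apply: linear_Kmulr; apply: ev3_linear.
apply: (linear_ext (f := fun x => ev3 (x ∙ y) h k l) _ (lx y)) => [a u v|a b].
  by rewrite (amul_bilin).1 ev3_linear.
apply: (linear_ext (f := fun y => ev3 ((a ⊗ b) ∙ y) h k l) _ (ly _)) => [e u v|c d].
  by rewrite (amul_bilin).2 ev3_linear.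
rewrite amul_pure ev3_pure ev2_mul dmulE tlift_mull; apply: eq_tlift => h1 h2.
rewrite tlift_mull; apply: eq_tlift => k1 k2.
rewrite tlift_mulr; apply: eq_tlift => l1 l2.
by rewrite !ev3_pure mulrACA.
Qed.

Lemma counitl_lin (phi : H -> K^o) h :
  linear phi -> \sw_(h1, h2 <- Δ h) ε h1 * phi h2 = phi h.
Proof.
move=> lp; rewrite -[in RHS](counitlE h) (tlift_comp _ _ lp).
apply: eq_tlift => x y.
by rewrite (linear_atZ _ _ lp).
Qed.

Lemma counitr_lin (phi : H -> K^o) h :
  linear phi -> \sw_(h1, h2 <- Δ h) phi h1 * ε h2 = phi h.
Proof.
move=> lp; rewrite -[in RHS](counitrE h) (tlift_comp _ _ lp).
by apply: eq_tlift => x y; rewrite (linear_atZ _ _ lp); apply: mulrC.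
Qed.

Lemma ev3_1l f (t : Hs ⊗ Hs) h k l :
  ev3 (tassocV (f ⊗ t)) h k l = f h * ev2 t k l.
Proof.
apply: (linear_ext (f := fun t => ev3 (tassocV (f ⊗ t)) h k l)
   (g := fun t => f h * ev2 t k l : K^o)) => [a u v|a u v|a b].
- by rewrite (tpure_bilin _ _).2 tassocV_linear ev3_linear.
- by rewrite ev2_linear mulrDr -scalerAr.
- by rewrite tassocV_pure ev3_pure !ev2_pure mulrA.
Qed.

Lemma ev3_comul (t : Hs ⊗ Hs) h k l :
  ev3 (tmap Δ idfun t) h k l = ev2 t (h ∙ k) l.
Proof.
rewrite /tmap (tlift_comp _ _ (ev3_linear h k l)).
by apply: eq_tlift => f g; rewrite ev3_pure; congr (_ * _); apply: dcomulE.
Qed.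

Lemma ev2_Δ1 h k : ev2 (Δ (𝟏 : Hs)) h k = ε (h ∙ k).
Proof. by rewrite [LHS]dual_comulE doneE. Qed.

Lemma linear_counitM (V : lmodType K) (f : V -> H) (k : H) :
  linear f -> linear (fun x => ε (f x ∙ k) : K^o).
Proof. by move=> lf; apply: linear_lin; apply: linear_mull. Qed.

Lemma linear_counitMr (V : lmodType K) (f : V -> H) (k : H) :
  linear f -> linear (fun x => ε (k ∙ f x) : K^o).
Proof. by move=> lf; apply: linear_lin; apply: linear_mulr. Qed.

Lemma dual_comul1l :
  tassocV ((𝟏 : Hs) ⊗ Δ (𝟏 : Hs)) ∙ (Δ (𝟏 : Hs) ⊗ (𝟏 : Hs)) =
  tmap Δ idfun (Δ (𝟏 : Hs)).
Proof.
apply: ev3_inj => h k l; rewrite ev3_mul ev3_comul ev2_Δ1 counitM21.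
transitivity (\sw_(h1, h2 <- Δ h) ε h1 *
   \sw_(k1, k2 <- Δ k) (ε (h2 ∙ k2) * ε (k1 ∙ l) : K^o)).
  apply: eq_tlift => h1 h2; rewrite tlift_mulr; apply: eq_tlift => k1 k2.
  rewrite -(counitr_lin (phi := fun l => ε h1 * (ε (h2 ∙ k2) * ε (k1 ∙ l)))); last first.
    by do 2 apply: linear_Kmulr; apply: linear_counitMr; lin.
  apply: eq_tlift => l1 l2.
  by rewrite ev3_1l ev3_pure !ev2_Δ1 !doneE -!mulrA; congr (_ * _); rewrite mulrCA.
rewrite (counitl_lin (phi := fun h => \sw_(k1, k2 <- Δ k)
   (ε (h ∙ k2) * ε (k1 ∙ l) : K^o))) //.
by apply: linear_param => ? ?; apply: linear_Kmull; apply: linear_counitM; lin.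
Qed.

Lemma dual_comul1r :
  (Δ (𝟏 : Hs) ⊗ (𝟏 : Hs)) ∙ tassocV ((𝟏 : Hs) ⊗ Δ (𝟏 : Hs)) =
  tmap Δ idfun (Δ (𝟏 : Hs)).
Proof.
apply: ev3_inj => h k l; rewrite ev3_mul ev3_comul ev2_Δ1 counitM12.
transitivity (\sw_(h1, h2 <- Δ h)
   (\sw_(k1, k2 <- Δ k) (ε (h1 ∙ k1) * ε (k2 ∙ l) : K^o)) * ε h2).
  apply: eq_tlift => h1 h2; rewrite tlift_mull; apply: eq_tlift => k1 k2.
  rewrite -(counitl_lin (phi := fun l => ε (h1 ∙ k1) * ε (k2 ∙ l) * ε h2)); last first.
    by apply: linear_Kmull; apply: linear_Kmulr; apply: linear_counitMr; lin.
  apply: eq_tlift => l1 l2.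
  rewrite ev3_1l ev3_pure !ev2_Δ1 !doneE.
  by rewrite [ε h2 * _]mulrC !mulrA; congr (_ * _ * _); apply: mulrC.
rewrite (counitr_lin (phi := fun h => \sw_(k1, k2 <- Δ k)
   (ε (h ∙ k1) * ε (k2 ∙ l) : K^o))) //.
by apply: linear_param => ? ?; apply: linear_Kmull; apply: linear_counitM; lin.
Qed.

HB.instance Definition _ := isWeakBialgebra.Build K Hs
  dual_comulM dual_counitM12 dual_counitM21 dual_comul1l dual_comul1r.

Definition dual_antipode (f : Hs) : Hs := linfun (fun h => f (antipode h)).

Lemma dual_antipodeE f h : dual_antipode f h = f (antipode h).
Proof.
rewrite /dual_antipode linfunE //.
by apply: linear_lin; apply: linear_lin0.
Qed.

Lemma dual_antipode_linear : linear dual_antipode.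
Proof.
move=> a f g; apply: dual_ext => h.
by rewrite add_lfunE scale_lfunE !dual_antipodeE add_lfunE scale_lfunE.
Qed.

HB.instance Definition _ := GRing.isLinear.Build K Hs Hs _
  dual_antipode dual_antipode_linear.

Lemma dual_counit_tE (f : Hs) h : (counit_t f : Hs) h = f (counit_t h).
Proof.
rewrite /counit_t tlift_eval (tlift_comp _ _ (dual_linear f)).
transitivity (\sw_(x, y <- Δ (𝟏 : Hs)) \sw_(a, b <- Δ (𝟏 : H))
   ((x : Hs) a * (y : Hs) h * f b : K^o)).
  apply: eq_tlift => x y; rewrite scale_lfunE dcounitE dmulE [LHS]tlift_mull.
  by apply: eq_tlift => a b; rewrite mulrAC.
rewrite tlift_swap; apply: eq_tlift => a b.
rewrite -tlift_mull dcomulE doneE linear_atZ //; exact: dual_linear.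
Qed.

Lemma dual_counit_sE (f : Hs) h : (counit_s f : Hs) h = f (counit_s h).
Proof.
rewrite /counit_s tlift_eval (tlift_comp _ _ (dual_linear f)).
transitivity (\sw_(x, y <- Δ (𝟏 : Hs)) \sw_(a, b <- Δ (𝟏 : H))
   (f a * ((x : Hs) h * (y : Hs) b) : K^o)).
  apply: eq_tlift => x y; rewrite scale_lfunE dcounitE dmulE [LHS]tlift_mull.
  by apply: eq_tlift => a b; rewrite -mulrA; congr (_ * _); apply: mulrC.
rewrite tlift_swap; apply: eq_tlift => a b.
rewrite -tlift_mulr dcomulE doneE linear_atZ; last exact: dual_linear.
exact: mulrC.
Qed.

Lemma dual_antipode_t (f : Hs) :
  \sw_(f1, f2 <- Δ f) f1 ∙ dual_antipode f2 = counit_t f.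
Proof.
apply: dual_ext => h; rewrite tlift_eval dual_counit_tE -antipode_t.
rewrite (tlift_comp _ _ (dual_linear f)).
transitivity (\sw_(x, y <- Δ f) \sw_(a, b <- Δ h)
   ((x : Hs) a * (y : Hs) (antipode b) : K^o)).
  apply: eq_tlift => x y; rewrite dmulE.
  by apply: eq_tlift => a b; rewrite dual_antipodeE.
by rewrite tlift_swap; apply: eq_tlift => a b; rewrite dcomulE.
Qed.

Lemma dual_antipode_s (f : Hs) :
  \sw_(f1, f2 <- Δ f) dual_antipode f1 ∙ f2 = counit_s f.
Proof.
apply: dual_ext => h; rewrite tlift_eval dual_counit_sE -antipode_s.
rewrite (tlift_comp _ _ (dual_linear f)).
transitivity (\sw_(x, y <- Δ f) \sw_(a, b <- Δ h)
   ((x : Hs) (antipode a) * (y : Hs) b : K^o)).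
  apply: eq_tlift => x y; rewrite dmulE.
  by apply: eq_tlift => a b; rewrite dual_antipodeE.
by rewrite tlift_swap; apply: eq_tlift => a b; rewrite dcomulE.
Qed.

Lemma dual_antipode_ss (f : Hs) :
  \sw_(f12, f3 <- Δ f) \sw_(f1, f2 <- Δ f12)
    dual_antipode f1 ∙ f2 ∙ dual_antipode f3 = dual_antipode f.
Proof.
apply: dual_ext => h; rewrite tlift_eval dual_antipodeE -antipode_ss.
rewrite (tlift_comp _ _ (dual_linear f)).
transitivity (\sw_(x, y <- Δ f) \sw_(a, b <- Δ h) \sw_(c, d <- Δ a)
   ((x : Hs) (antipode c ∙ d) * (y : Hs) (antipode b) : K^o)).
  apply: eq_tlift => x y; rewrite tlift_eval.
  transitivity (\sw_(x1, x2 <- Δ x) \sw_(a, b <- Δ h) \sw_(c, d <- Δ a)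
   ((x1 : Hs) (antipode c) * (x2 : Hs) d * (y : Hs) (antipode b) : K^o)).
    apply: eq_tlift => x1 x2; rewrite dmulE; apply: eq_tlift => a b.
    rewrite dmulE tlift_mull; apply: eq_tlift => c d.
    by rewrite !dual_antipodeE.
  rewrite tlift_swap; apply: eq_tlift => a b; rewrite tlift_swap.
  by apply: eq_tlift => c d; rewrite -tlift_mull dcomulE.
rewrite tlift_swap; apply: eq_tlift => a b; rewrite tlift_swap.
rewrite (tlift_comp _ _ (dual_linear f)).
by apply: eq_tlift => c d; rewrite dcomulE.
Qed.

HB.instance Definition _ := isWeakHopf.Build K Hs
  dual_antipode_t dual_antipode_s dual_antipode_ss.

End Dual.

Section PartialComodule.
Variables (K : fieldType) (H : weakHopfType K) (C : coalgType K).

(* m_H ⊗ I_X, on H ⊗ H ⊗ X bracketed to the right *)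
Definition mul_id (X : lmodType K) (t : H ⊗ (H ⊗ X)) : H ⊗ X :=
  tmap (@amulT K H) idfun (tassocV t).

Record partial_coaction (rho : C -> H ⊗ C) : Prop := {
  pcoact_counit : forall c, tunitl (tmap ε idfun (rho c)) = c;
  pcoact_comul : forall c,
    tmap idfun Δ (rho c) =
    tmap (@amulT K H) idfun (tmid (tmap rho rho (Δ c)));
  pcoact_coact : forall c,
    tmap idfun rho (rho c) =
    mul_id (\sw_(c1, c2 <- Δ c)
              tunitr (tmap idfun ε (rho c1)) ⊗ tassoc (tmap Δ idfun (rho c2)))
}.

(* The sum lies in (H ⊗ (H ⊗ C)) ⊗ H; it is rebracketed to H ⊗ ((H ⊗ C) ⊗ H)
   before I_H ⊗ τ_{H ⊗ C, H} is applied. *)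
Definition symmetric_coaction (rho : C -> H ⊗ C) : Prop := forall c,
  tmap idfun rho (rho c) =
  mul_id (tmap idfun (@tswap K (H ⊗ C)%type H) (tassoc
    (\sw_(c1, c2 <- Δ c)
       tassoc (tmap Δ idfun (rho c1)) ⊗ tunitr (tmap idfun ε (rho c2))))).

Definition partial_comodule_coalgebra : Prop :=
  exists rho : {linear C -> (H ⊗ C)%type}, partial_coaction rho.

Definition symmetric_partial_comodule_coalgebra : Prop :=
  exists rho : {linear C -> (H ⊗ C)%type},
    partial_coaction rho /\ symmetric_coaction rho.

End PartialComodule.

Section PartialModule.
Variables (K : fieldType) (C : coalgType K) (A : weakHopfType K).

Record partial_action (act : C ⊗ A -> C) : Prop := {
  pact_unit : forall c, act (c ⊗ 𝟏) = c;
  pact_comul : forall c h,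
    Δ (act (c ⊗ h)) =
    \sw_(c1, c2 <- Δ c) \sw_(h1, h2 <- Δ h) act (c1 ⊗ h1) ⊗ act (c2 ⊗ h2);
  pact_act : forall c h k,
    act (act (c ⊗ h) ⊗ k) =
    \sw_(c1, c2 <- Δ c) \sw_(h1, h2 <- Δ h)
      (ε (act (c1 ⊗ h1)) : K) *: act (c2 ⊗ (h2 ∙ k))
}.

Definition symmetric_action (act : C ⊗ A -> C) : Prop := forall c h k,
  act (act (c ⊗ h) ⊗ k) =
  \sw_(c1, c2 <- Δ c) \sw_(h1, h2 <- Δ h)
    (ε (act (c2 ⊗ h2)) : K) *: act (c1 ⊗ (h1 ∙ k)).

Definition partial_module_coalgebra : Prop :=
  exists act : {linear (C ⊗ A)%type -> C}, partial_action act.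

Definition symmetric_partial_module_coalgebra : Prop :=
  exists act : {linear (C ⊗ A)%type -> C},
    partial_action act /\ symmetric_action act.

End PartialModule.

(* Main.v *)
Require Import Defs.
From HB Require Import structures.
From mathcomp Require Import all_boot all_order all_algebra.

(** The two structures are the same map read in two ways.  As [H] is finite
    dimensional, a linear map [rho : C -> H ⊗ C] amounts to a linear map
    [act : C ⊗ H^* -> C], through
      [act (c ⊗ f) = (f ⊗ I_C) (rho c)],
    where the right-hand side is the contraction of the leg in [H] by [f].  A
    tensor with a leg in [H] is determined by its contractions ([contract_inj]),
    so an identity between elements of [H ⊗ X] can be tested by contracting by
    every [f].  Under this test each comodule axiom for [rho] becomes the module
    axiom for [act] at the same place in the definition: the counit of [H] is
    the unit of [H^*], a product in [H] turns into the coproduct of [H^*]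
    ([contract_mul]), and a coproduct in [H] turns into the product of [H^*]
    ([contract_coact], [contract_symm]).  Hence, for two maps that correspond to
    each other, the axioms are equivalent one by one; the symmetry condition is
    a separate axiom treated in the same way. *)

Section Contraction.

Set Implicit Arguments.
Unset Strict Implicit.

Import GRing.Theory.
Local Open Scope ring_scope.

Variables (K : fieldType) (H : finWeakHopfType K).
Local Notation Hs := (dual H).
Local Notation bas := (vbasis (@fullv K H)).

(** * Contraction of a tensor by a linear form *)

Section Basic.
Variable X : lmodType K.
Implicit Types (f k : Hs) (x : H ⊗ X).

Definition contract f x : X := \sw_(h, v <- x) f h *: v.

Lemma contract_bilin f : bilin (fun (h : H) (v : X) => f h *: v).
Proof.
split=> [v|h]; last by lin.
by apply: (@linear_scalel _ _ _ (fun h : H => f h : K^o)); apply: dual_linear.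
Qed.

Lemma contract_linear f : linear (contract f).
Proof. exact/tlift_linear/contract_bilin. Qed.

Lemma contract_pure f h (v : X) : contract f (h ⊗ v) = f h *: v.
Proof. by rewrite /contract tlift_pure //; apply: contract_bilin. Qed.

Lemma contract_linearl x : linear (fun f => contract f x).
Proof.
apply: linear_param => h v.
by apply: (@linear_scalel _ _ _ (fun f : Hs => f h : K^o)); apply: linear_eval; lin.
Qed.

Lemma contract_sw (V W : lmodType K) (t : V ⊗ W) (F : V -> W -> H ⊗ X) f :
  contract f (tlift t F) = \sw_(v, w <- t) contract f (F v w).
Proof. by rewrite (tlift_comp _ _ (contract_linear f)). Qed.

(** Contracting by the coordinate forms gives the components of [x] along a
    basis of [H]. *)
Lemma contract_decomp x :
  x = \sum_(i < \dim (@fullv K H))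
        bas`_i ⊗ contract (linfun (coord bas i : H -> K^o)) x.
Proof.
pose g x := \sum_(i < \dim (@fullv K H))
  bas`_i ⊗ contract (linfun (coord bas i : H -> K^o)) x.
apply: (@linear_ext K H X _ (fun t => t) g) => [|a y z|h v].
- exact: linear_id.
- rewrite /g scaler_sumr -big_split /=; apply: eq_bigr => i _.
  by rewrite contract_linear; apply: (tpure_bilin _ _).2.
- rewrite /g {1}(coord_vbasis (memvf h)) (Defs.linear_sum ((tpure_bilin _ _).1 v)) /=.
  apply: eq_bigr => i _; rewrite contract_pure linfunE; last exact: linearP.
  rewrite bilinZl; last exact: tpure_bilin.
  by rewrite (linear_atZ _ _ ((tpure_bilin H X).2 _)).
Qed.

Lemma contract_inj x y : (forall f, contract f x = contract f y) -> x = y.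
Proof.
by move=> E; rewrite (contract_decomp x) (contract_decomp y); apply: eq_bigr => i _; rewrite E.
Qed.

Lemma contract_one x : contract 𝟏 x = tunitl (tmap ε idfun x).
Proof.
rewrite /tmap (tlift_comp _ _ (@tunitl_linear _ _)).
by apply: eq_tlift => h v; rewrite tunitl_pure doneE.
Qed.

End Basic.

Lemma contract_map (X Y : lmodType K) (g : X -> Y) (f : Hs) (x : H ⊗ X) :
  linear g -> contract f (tmap idfun g x) = g (contract f x).
Proof.
move=> lg; rewrite /tmap contract_sw (tlift_comp _ _ lg).
by apply: eq_tlift => h v; rewrite contract_pure (linear_atZ _ _ lg).
Qed.

(** * What contraction does to the structure maps *)

Lemma amulT_linear : linear (@amulT K H).
Proof. by apply: tlift_linear; exact: amul_bilin. Qed.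

Lemma sw_exchange (U : nmodType) (V W V' W' : lmodType K)
    (t : V ⊗ W) (t' : V' ⊗ W') (F : V -> W -> V' -> W' -> U) :
  \sw_(a, b <- t) \sw_(c, d <- t') F a b c d =
  \sw_(c, d <- t') \sw_(a, b <- t) F a b c d.
Proof. exact: exchange_big. Qed.

Lemma dual_comul_scale (f : Hs) h k (X : lmodType K) (v : X) :
  \sw_(f1, f2 <- Δ f) ((f1 : Hs) h * (f2 : Hs) k) *: v = f (h ∙ k) *: v.
Proof. by rewrite -dcomulE [RHS]scaler_suml. Qed.

(** The coproduct of [f] is dual to the product that multiplies the two legs
    in [H]. *)
Lemma contract_mul (X Y : lmodType K) (f : Hs) (x : H ⊗ X) (y : H ⊗ Y) :
  contract f (tmap (@amulT K H) idfun (tmid (x ⊗ y))) =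
  \sw_(f1, f2 <- Δ f) contract f1 x ⊗ contract f2 y.
Proof.
have lA := amulT_linear.
have lL : linear (fun t : (H ⊗ X) ⊗ (H ⊗ Y) =>
    contract f (tmap (@amulT K H) idfun (tmid t))).
  by move=> a u v; rewrite tmid_linear tmap_linear // contract_linear.
apply: (linear_ext (f := fun x => contract f (tmap (@amulT K H) idfun (tmid (x ⊗ y))))
  (g := fun x => \sw_(f1, f2 <- Δ f) contract f1 x ⊗ contract f2 y)) => [||h u].
- by move=> a u v; rewrite (tpure_bilin _ _).1 lL.
- by apply: linear_param => f1 f2; apply: linear_tpurel; apply: contract_linear.
apply: (linear_ext
  (f := fun y => contract f (tmap (@amulT K H) idfun (tmid ((h ⊗ u) ⊗ y))))
  (g := fun y => \sw_(f1, f2 <- Δ f) contract f1 (h ⊗ u) ⊗ contract f2 y)) => [||k v].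
- by move=> a w w'; rewrite (tpure_bilin _ _).2 lL.
- by apply: linear_param => f1 f2; apply: linear_tpurer; apply: contract_linear.
rewrite tmid_pure tmap_pure // contract_pure /amulT tlift_pure; last exact: amul_bilin.
rewrite -dual_comul_scale; apply: eq_tlift => f1 f2; rewrite !contract_pure.
rewrite (bilinZl _ _ _ (tpure_bilin X Y)) -scalerA; congr (_ *: _).
by rewrite (linear_atZ _ _ ((tpure_bilin X Y).2 _)).
Qed.

Lemma mul_id_linear (X : lmodType K) : linear (@mul_id K H X).
Proof.
have lA := amulT_linear.
by move=> a x y; rewrite /mul_id tassocV_linear tmap_linear.
Qed.

Lemma mul_id_pure (X : lmodType K) (a b : H) (x : X) : mul_id (a ⊗ (b ⊗ x)) = (a ∙ b) ⊗ x.
Proof.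
have lA := amulT_linear.
rewrite /mul_id tassocV_pure tmap_pure // /amulT tlift_pure //.
exact: amul_bilin.
Qed.

Section TwoLegs.
Variable X : lmodType K.
Implicit Types (f k : Hs) (a : H) (y : H ⊗ X).

Lemma contract2_inj (t t' : H ⊗ (H ⊗ X)) :
  (forall f k, contract k (contract f t) = contract k (contract f t')) -> t = t'.
Proof. by move=> E; do 2 apply: contract_inj => ?; apply: E. Qed.

Lemma contract2_linear f k :
  linear (fun t : H ⊗ (H ⊗ X) => contract k (contract f t)).
Proof. by move=> a x y; rewrite !contract_linear. Qed.

Lemma tassoc_comul_linear : linear (fun y => tassoc (tmap Δ idfun y)).
Proof. by move=> a x y; rewrite tmap_linear ?tassoc_linear //; lin. Qed.

Lemma tassoc_comul_pure (h : H) (x : X) :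
  tassoc (tmap Δ idfun (h ⊗ x)) = \sw_(h1, h2 <- Δ h) h1 ⊗ (h2 ⊗ x).
Proof.
rewrite tmap_pure; [|by lin..].
by rewrite /tassoc tlift_pure //; lin.
Qed.

(** On [y = h ⊗ x] both sides are [f (a h_1) k (h_2) x]: the coproduct of [f]
    separates [a] from [h_1], and the product with [k] gathers [h_1] and [h_2]. *)
Lemma contract_coact f k a y :
  contract k (contract f (mul_id (a ⊗ tassoc (tmap Δ idfun y)))) =
  \sw_(f1, f2 <- Δ f) (f1 : Hs) a *: contract (f2 ∙ k) y.
Proof.
pose L (t : H ⊗ (H ⊗ (H ⊗ X))) := contract k (contract f (mul_id t)).
have lL : linear L by move=> b u v; rewrite /L mul_id_linear contract2_linear.
have lLa : linear (fun t => L (a ⊗ t)).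
  by move=> b u v; rewrite (tpure_bilin _ _).2 lL.
apply: (linear_ext (f := fun y => L (a ⊗ tassoc (tmap Δ idfun y)))
  (g := fun y => \sw_(f1, f2 <- Δ f) (f1 : Hs) a *: contract (f2 ∙ k) y)) => [||h x].
- by move=> b u v; rewrite tassoc_comul_linear lLa.
- by apply: linear_param => f1 f2; apply: linear_scaler; exact: (contract_linear (X := X)).
rewrite tassoc_comul_pure (tlift_comp _ _ lLa).
transitivity (\sw_(f1, f2 <- Δ f) \sw_(h1, h2 <- Δ h)
   ((f1 : Hs) a * (f2 : Hs) h1) *: (k h2 *: x)).
  rewrite [RHS]sw_exchange; apply: eq_tlift => h1 h2.
  rewrite /L mul_id_pure contract_pure (linear_atZ _ _ (contract_linear k)).
  by rewrite contract_pure [RHS]dual_comul_scale.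
apply: eq_tlift => f1 f2; rewrite contract_pure dmulE [X in _ *: X]scaler_suml.
by rewrite scaler_sumr; apply: eq_bigr => p _; rewrite !scalerA mulrA.
Qed.

(** The same with [a] on the right: both sides are [f (h_1 a) k (h_2) x]. *)
Lemma contract_symm f k a y :
  contract k (contract f (mul_id (tmap idfun (@tswap K (H ⊗ X)%type H)
    (tassoc (tassoc (tmap Δ idfun y) ⊗ a))))) =
  \sw_(f1, f2 <- Δ f) (f2 : Hs) a *: contract (f1 ∙ k) y.
Proof.
pose L (t : (H ⊗ (H ⊗ X)) ⊗ H) := contract k (contract f (mul_id (tmap idfun (@tswap K (H ⊗ X)%type H)
  (tassoc t)))).
have lS : linear (@tswap K (H ⊗ X)%type H) by apply: tlift_linear; lin.
have lL : linear L.
  move=> b u v.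
  by rewrite /L tassoc_linear tmap_linear // mul_id_linear contract2_linear.
have lLa : linear (fun t => L (t ⊗ a)).
  by move=> b u v; rewrite (tpure_bilin _ _).1 lL.
apply: (linear_ext (f := fun y => L (tassoc (tmap Δ idfun y) ⊗ a))
  (g := fun y => \sw_(f1, f2 <- Δ f) (f2 : Hs) a *: contract (f1 ∙ k) y)) => [||h x].
- by move=> b u v; rewrite tassoc_comul_linear lLa.
- by apply: linear_param => f1 f2; apply: linear_scaler; exact: (contract_linear (X := X)).
rewrite tassoc_comul_pure (tlift_comp _ _ lLa).
transitivity (\sw_(f1, f2 <- Δ f) \sw_(h1, h2 <- Δ h)
   ((f1 : Hs) h1 * (f2 : Hs) a) *: (k h2 *: x)).
  rewrite [RHS]sw_exchange; apply: eq_tlift => h1 h2.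
  rewrite /L tassoc_pure tmap_pure // /tswap tlift_pure; last by lin.
  rewrite mul_id_pure contract_pure (linear_atZ _ _ (contract_linear k)).
  by rewrite contract_pure [RHS]dual_comul_scale.
apply: eq_tlift => f1 f2; rewrite contract_pure dmulE [X in _ *: X]scaler_suml.
by rewrite scaler_sumr; apply: eq_bigr => p _; rewrite !scalerA mulrCA mulrA.
Qed.

End TwoLegs.

Section Correspondence.
Variable C : coalgType K.

(** This recovers the scalar factor of the partial axioms: the element of [H] in
    the coaction axioms, seen by a form [f1], is the number [ε (act (c1 ⊗ f1))]. *)
Lemma eval_counit_contract (f : Hs) (y : H ⊗ C) :
  f (tunitr (tmap idfun ε y)) = ε (contract f y).
Proof.
rewrite /tmap (tlift_comp _ _ (@tunitr_linear _ _)) (tlift_comp _ _ (dual_linear f)).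
rewrite (tlift_comp _ _ (@linear_lin0 _ _ _ ε)); apply: eq_tlift => h c.
by rewrite tunitr_pure (linear_atZ _ _ (dual_linear f)) linearZ; apply: mulrC.
Qed.

(** * Maps [C -> H ⊗ C] against maps [C ⊗ H^* -> C] *)

Definition dual_pair (rho : C -> H ⊗ C) (act : C ⊗ Hs -> C) : Prop :=
  forall c f, act (c ⊗ f) = contract f (rho c).

Definition linear_pack (V W : lmodType K) (f : V -> W) (lf : linear f) :
  {linear V -> W} := HB.pack f (GRing.isLinear.Build K V W _ f lf).

Lemma dual_pair_action (rho : {linear C -> (H ⊗ C)%type}) :
  exists act : {linear (C ⊗ Hs)%type -> C}, dual_pair rho act.
Proof.
have bF : bilin (fun c f => contract f (rho c)).
  split=> [f|c]; last exact: contract_linearl.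
  exact: linear_comp (contract_linear f) (linear_lin0 rho).
exists (linear_pack (tlift_linear bF)) => c f /=.
by rewrite tlift_pure.
Qed.

(** The map [rho] is forced: its components along a basis [e] of [H] have to be
    the values of [act (c ⊗ f)] at the forms [f] of the dual basis. *)
Lemma dual_pair_coaction (act : {linear (C ⊗ Hs)%type -> C}) :
  exists rho : {linear C -> (H ⊗ C)%type}, dual_pair rho act.
Proof.
pose r (c : C) : H ⊗ C := \sum_(i < \dim (@fullv K H))
  bas`_i ⊗ act (c ⊗ linfun (coord bas i : H -> K^o)).
have lr : linear r.
  move=> a x y; rewrite /r scaler_sumr -big_split /=; apply: eq_bigr => i _.
  by rewrite (tpure_bilin _ _).1 linearP (tpure_bilin _ _).2.
exists (linear_pack lr) => c f /=.
have la : linear (fun f => act (c ⊗ f)) by lin.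
rewrite /r (Defs.linear_sum (contract_linear f)) {1}(dual_decomp f).
rewrite (Defs.linear_sum la); apply: eq_bigr => i _.
by rewrite contract_pure (linear_atZ _ _ la).
Qed.

Section DualPair.
Variables (rho : {linear C -> (H ⊗ C)%type}) (act : {linear (C ⊗ Hs)%type -> C}).
Hypothesis pair : dual_pair rho act.

(** Contracting the iterated coaction in both legs applies the action twice;
    the outer leg is consumed first. *)
Lemma contract_rho2 c f k :
  contract k (contract f (tmap idfun rho (rho c))) = act (act (c ⊗ f) ⊗ k).
Proof. by rewrite contract_map ?pair //; apply: linear_lin0. Qed.

Lemma contract_coact_rhs c f k :
  contract k (contract f (mul_id (\sw_(c1, c2 <- Δ c)
    tunitr (tmap idfun ε (rho c1)) ⊗ tassoc (tmap Δ idfun (rho c2))))) =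
  \sw_(c1, c2 <- Δ c) \sw_(f1, f2 <- Δ f)
    (ε (act (c1 ⊗ f1)) : K) *: act (c2 ⊗ (f2 ∙ k)).
Proof.
rewrite (tlift_comp _ _ (@mul_id_linear (H ⊗ C)%type)) (tlift_comp _ _ (@contract2_linear C f k)).
apply: eq_tlift => c1 c2; rewrite contract_coact; apply: eq_tlift => f1 f2.
by rewrite eval_counit_contract !pair.
Qed.

Lemma contract_symm_rhs c f k :
  contract k (contract f (mul_id (tmap idfun (@tswap K (H ⊗ C)%type H) (tassoc
    (\sw_(c1, c2 <- Δ c)
       tassoc (tmap Δ idfun (rho c1)) ⊗ tunitr (tmap idfun ε (rho c2))))))) =
  \sw_(c1, c2 <- Δ c) \sw_(f1, f2 <- Δ f)
    (ε (act (c2 ⊗ f2)) : K) *: act (c1 ⊗ (f1 ∙ k)).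
Proof.
have lS : linear (@tswap K (H ⊗ C)%type H) by apply: tlift_linear; lin.
rewrite (tlift_comp _ _ (@tassoc_linear _ _ _ _)).
rewrite (tlift_comp _ _ (tmap_linear (@linear_id K H) lS)).
rewrite (tlift_comp _ _ (@mul_id_linear (H ⊗ C)%type)) (tlift_comp _ _ (@contract2_linear C f k)).
apply: eq_tlift => c1 c2; rewrite contract_symm; apply: eq_tlift => f1 f2.
by rewrite eval_counit_contract !pair.
Qed.

Lemma contract_comul_rhs c f :
  contract f (tmap (@amulT K H) idfun (tmid (tmap rho rho (Δ c)))) =
  \sw_(c1, c2 <- Δ c) \sw_(f1, f2 <- Δ f) act (c1 ⊗ f1) ⊗ act (c2 ⊗ f2).
Proof.
have lA := amulT_linear.
rewrite [tmap rho rho _]/tmap (tlift_comp _ _ (@tmid_linear _ _ _ _ _)).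
rewrite (tlift_comp _ _ (tmap_linear lA (@linear_id K (C ⊗ C)%type))) contract_sw.
apply: eq_tlift => c1 c2; rewrite contract_mul; apply: eq_tlift => f1 f2.
by rewrite !pair.
Qed.

Lemma contract_comul_lhs c f : contract f (tmap idfun Δ (rho c)) = Δ (act (c ⊗ f)).
Proof. by rewrite contract_map ?pair //; apply: linear_lin0. Qed.

Lemma partial_coaction_action : partial_coaction rho <-> partial_action act.
Proof.
split=> -[H1 H2 H3]; split.
- by move=> c; rewrite pair contract_one.
- by move=> c f; rewrite -contract_comul_lhs H2 contract_comul_rhs.
- by move=> c f k; rewrite -contract_rho2 H3 contract_coact_rhs.
- by move=> c; rewrite -contract_one -pair.
- by move=> c; apply: contract_inj => f; rewrite contract_comul_lhs H2 contract_comul_rhs.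
- by move=> c; apply: contract2_inj => f k; rewrite contract_rho2 H3 contract_coact_rhs.
Qed.

Lemma symmetric_coaction_action : symmetric_coaction rho <-> symmetric_action act.
Proof.
split=> E c.
- by move=> f k; rewrite -contract_rho2 E contract_symm_rhs.
- by apply: contract2_inj => f k; rewrite contract_rho2 E contract_symm_rhs.
Qed.

End DualPair.
End Correspondence.
End Contraction.

Theorem mainTheorem14 (K : fieldType) (H : finWeakHopfType K) (C : coalgType K) :
  (partial_comodule_coalgebra H C <-> partial_module_coalgebra C (dual H)) /\
  (symmetric_partial_comodule_coalgebra H C <->
   symmetric_partial_module_coalgebra C (dual H)).
Proof.
split; split.
- move=> [rho Hr]; have [act pair] := dual_pair_action rho.
  by exists act; apply/(partial_coaction_action pair).
- move=> [act Ha]; have [rho pair] := dual_pair_coaction act.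
  by exists rho; apply/(partial_coaction_action pair).
- move=> [rho [Hr Sr]]; have [act pair] := dual_pair_action rho.
  exists act; split; first exact/(partial_coaction_action pair).
  exact/(symmetric_coaction_action pair).
- move=> [act [Ha Sa]]; have [rho pair] := dual_pair_coaction act.
  exists rho; split; first exact/(partial_coaction_action pair).
  exact/(symmetric_coaction_action pair).
Qed.
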